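(* Let $X=\sigma(\{0,1\}^{\omega_1})=\{x\in\{0,1\}^{\omega_1}:|\operatorname{supp}x|\leq\omega\}$, where $\operatorname{supp}x=\{\alpha\in\omega_1:x(\alpha)=1\}$, equipped with the topology generated by the base $$\mathcal B=\{\operatorname{pr}_A^{-1}(x):A\in[\omega_1]^{\leq\omega},\ x\in\{0,1\}^A\},$$ where $\operatorname{pr}_A:X\to\{0,1\}^A$ is the projection (restriction to $A$). Then $X$ is F-Y countably domain representable, but $X$ is not F-Y $\pi$-domain representable.
   Context: $[\omega_1]^{\leq\omega}$ is the set of countable (possibly finite) subsets of $\omega_1$. For a topological space $X$, $\tau(X)$ denotes its topology and $\tau^*(X)$ the family of nonempty open sets. A family $\mathcal P$ of nonempty open sets is a $\pi$-base if for every nonempty open $U$ there is $P\in\mathcal P$ with $P\subseteq U$. A set $D$ with a relation $\ll$ is upward directed if it is nonempty and for all $p,q\in D$ (not necessarily distinct) there is $r\in D$ with $p\ll r$ and $q\ll r$. $X$ is F-Y (Fleissner--Yengulalp) countably domain representable if there is a triple $(Q,\ll,B)$ such that: (D1) $B:Q\to\tau^*(X)$ and $\{B(q):q\in Q\}$ is a base for $\tau(X)$; (D2) $\ll$ is a transitive relation on $Q$ (antisymmetry is not assumed); (D3) for all $p,q\in Q$, $p\ll q$ implies $B(p)\supseteq B(q)$; (D4) for all $x\in X$, the set $\{q\in Q:x\in B(q)\}$ is upward directed by $\ll$; (D5$_{\omega_1}$) if $D\subseteq Q$ and $(D,\ll)$ is countable and upward directed, then $\bigcap\{B(q):q\in D\}\neq\emptyset$.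 $X$ is F-Y $\pi$-domain representable if there is a triple $(Q,\ll,B)$ such that: ($\pi$D1) $B:Q\to\tau^*(X)$ and $\{B(q):q\in Q\}$ is a $\pi$-base for $\tau(X)$; ($\pi$D2) $\ll$ is a transitive relation on $Q$ (antisymmetry is not assumed); ($\pi$D3) for all $p,q\in Q$, $p\ll q$ implies $B(p)\supseteq B(q)$; ($\pi$D4) if $p,q\in Q$ satisfy $B(q)\cap B(p)\neq\emptyset$, there exists $r\in Q$ with $p\ll r$ and $q\ll r$; ($\pi$D5) if $D\subseteq Q$ and $(D,\ll)$ is upward directed (of any cardinality), then $\bigcap\{B(q):q\in D\}\neq\emptyset$. *)

(* Defs.v *)
From HB Require Import structures.
From mathcomp Require Import all_boot all_order.
From mathcomp Require Import wochoice.
From mathcomp Require Import boolp classical_sets functions cardinality filter.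
From mathcomp Require Import topology.

Set Implicit Arguments.
Unset Strict Implicit.
Unset Printing Implicit Defensive.

Local Open Scope classical_set_scope.

(* [(W, le)] is a copy of the first uncountable ordinal: an uncountable set
   with a (reflexive) well-order all of whose proper initial segments are
   countable. This determines [(W, le)] up to order isomorphism. *)
Definition is_omega1 (W : Type) (le : rel W) : Prop :=
  [/\ well_order le,
      ~ countable [set: W] &
      forall a : W, countable [set b | le b a /\ b <> a]].

(* Such copies exist: take the elements with countably many predecessors in a
   well-order of an uncountable set. *)
Lemma omega1_exists : exists (W : Type) (le : rel W), is_omega1 le.
Proof.
pose T : choiceType := set nat.
have [R woR] := well_ordering_principle T.
have uT : ~ countable [set: T].
  move=> /countable_injP[f f_inj].
  pose D : T := [set n | exists2 A : T, f A = n & ~ A n].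
  have nD : ~ D (f D).
    move=> DfD; case: (DfD) => A fA nA.
    by have AD : A = D by [apply: f_inj; rewrite ?inE]; apply: nA; rewrite AD.
  by apply: (nD); exists D.
have Rtot x y : R x y || R y x.
  have [|z [[/orP zxy mz] _]] := woR [pred z | (z == x) || (z == y)].
    by exists x; rewrite inE eqxx.
  case: zxy => /eqP zE; rewrite zE in mz.
    by rewrite mz // inE eqxx orbT.
  by rewrite (mz x) ?orbT // inE eqxx.
have Ranti x y : R x y -> R y x -> x = y.
  move=> Rxy Ryx; have Rxx z : R z z by have := Rtot z z; rewrite orbb.
  have [|z [_ uz]] := woR [pred z | (z == x) || (z == y)].
    by exists x; rewrite inE eqxx.
  have <- : z = x.
    by apply: uz; split=> [|t /orP[] /eqP ->]; rewrite ?inE ?eqxx.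
  by apply: uz; split=> [|t /orP[] /eqP ->]; rewrite ?inE ?eqxx ?orbT.
pose P (x : T) := countable [set y | R y x /\ y <> x].
pose W := {x : T | P x}.
have sval_inj : injective (@sval T P).
  by move=> [x px] [y py] /= e; subst y; congr exist; apply: Prop_irrelevance.
exists W, (fun a b => R (sval a) (sval b)); split.
- move=> A [a Aa].
  have [|x [[/asboolP[b Ab <-] mb] ub]] :=
      woR [pred x | `[< exists2 b : W, b \in A & sval b = x >]].
    by exists (sval a); apply/asboolP; exists a.
  exists b; split; first by split=> // c Ac; apply: mb; apply/asboolP; exists c.
  move=> c [Ac mc]; apply: sval_inj; apply: ub; split.
    by apply/asboolP; exists c.
  by move=> y /asboolP[d Ad <-]; apply: mc.
- move=> /countable_injP[f f_inj].
  have cP : countable [set x | P x].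
    apply/countable_injP.
    exists (fun x => if pselect (P x) is left Px then f (exist P x Px) else 0).
    move=> x y; rewrite !inE /= => Px Py.
    case: pselect => // Px'; case: pselect => // Py' fxy.
    by have [] : exist P x Px' = exist P y Py' by apply: f_inj; rewrite ?inE.
  have [PT|/existsNP[x0 nx0]] := pselect (forall x, P x).
    by apply: uT; apply: sub_countable cP; apply: subset_card_le => x _; apply: PT.
  have [|x [[/asboolP nPx mx] _]] := woR [pred x | `[< ~ P x >]].
    by exists x0; apply/asboolP.
  apply: nPx; apply: sub_countable cP; apply: subset_card_le => y [Ryx yx] /=.
  apply: contrapT => nPy; apply: yx; apply: (Ranti) => //.
  by apply: mx; apply/asboolP.
- move=> a; have /countable_injP[f f_inj] := svalP a.
  apply/countable_injP; exists (f \o sval) => b c.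
  rewrite !inE => -[ba nba] [ca nca] /f_inj bc; apply: (sval_inj); apply: bc.
    by rewrite inE; split=> // /sval_inj.
  by rewrite inE; split=> // /sval_inj.
Qed.

Definition supp (W : Type) (x : W -> bool) : set W := [set a | x a].

(* An alias, so that the topology below does not compete with the product
   topology on [W -> bool]. *)
Definition sigma_cube (W : Type) : Type := {x : W -> bool | countable (supp x)}.

HB.instance Definition _ (W : Type) := gen_eqMixin (sigma_cube W).
HB.instance Definition _ (W : Type) := gen_choiceMixin (sigma_cube W).

Definition pr (W : Type) (A : set W) (x : sigma_cube W) : A -> bool :=
  fun a => sval x (val a).

Definition sigma_base (W : Type) : set (set (sigma_cube W)) :=
  [set U | exists2 A : set W, countable A &
             exists x : A -> bool, U = @pr W A @^-1` [set x]].

Lemma sigma_base_cover (W : Type) : \bigcup_(U in @sigma_base W) U = setT.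
Proof.
apply/seteqP; split=> // x _; exists (@pr W set0 @^-1` [set pr x]) => //.
by exists set0 => //; exists (pr x).
Qed.

Lemma sigma_base_join (W : Type) (U V : set (sigma_cube W)) (t : sigma_cube W) :
  sigma_base U -> sigma_base V -> U t -> V t ->
  exists O, [/\ sigma_base O, O t & O `<=` U `&` V].
Proof.
move=> [A cA [_ ->]] [B cB [_ ->]] <- <-.
exists (@pr W (A `|` B) @^-1` [set pr t]); split => //.
  exists (A `|` B); last by exists (pr t).
  by rewrite -bigcup2E; apply: bigcup_countable => // -[|[|]].
move=> y /= yt; split; apply: funext => -[a /= aP].
  have aAB : a \in A `|` B by rewrite inE; left; rewrite inE in aP.
  exact: (congr1 (@^~ (exist _ a aAB)) yt).
have aAB : a \in A `|` B by rewrite inE; right; rewrite inE in aP.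
exact: (congr1 (@^~ (exist _ a aAB)) yt).
Qed.

HB.instance Definition _ (W : Type) := @isBaseTopological.Build (sigma_cube W)
  (set (sigma_cube W)) (@sigma_base W) id
  (@sigma_base_cover W) (@sigma_base_join W).

Definition upward_directed (Q : Type) (ll : Q -> Q -> Prop) (D : set Q) : Prop :=
  D !=set0 /\
  forall p q, D p -> D q -> exists r, [/\ D r, ll p r & ll q r].

Definition pi_base (X : topologicalType) (P : set (set X)) : Prop :=
  (forall U, P U -> open U /\ U !=set0) /\
  (forall U : set X, open U -> U !=set0 -> exists2 V, P V & V `<=` U).

Record FY_countable_domain (X : topologicalType) (Q : Type)
    (ll : Q -> Q -> Prop) (B : Q -> set X) : Prop := FYCountableDomain {
  cD1 : (forall q, open (B q) /\ B q !=set0) /\ basis (range B);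
  cD2 : forall p q r, ll p q -> ll q r -> ll p r;
  cD3 : forall p q, ll p q -> B q `<=` B p;
  cD4 : forall x : X, upward_directed ll [set q | B q x];
  cD5 : forall D : set Q, countable D -> upward_directed ll D ->
        \bigcap_(q in D) B q !=set0 }.

Record FY_pi_domain (X : topologicalType) (Q : Type)
    (ll : Q -> Q -> Prop) (B : Q -> set X) : Prop := FYPiDomain {
  piD1 : (forall q, open (B q) /\ B q !=set0) /\ pi_base (range B);
  piD2 : forall p q r, ll p q -> ll q r -> ll p r;
  piD3 : forall p q, ll p q -> B q `<=` B p;
  piD4 : forall p q, B q `&` B p !=set0 -> exists r, ll p r /\ ll q r;
  piD5 : forall D : set Q, upward_directed ll D ->
         \bigcap_(q in D) B q !=set0 }.

Definition FY_countably_domain_representable (X : topologicalType) : Prop :=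
  exists (Q : Type) (ll : Q -> Q -> Prop) (B : Q -> set X),
    FY_countable_domain ll B.

Definition FY_pi_domain_representable (X : topologicalType) : Prop :=
  exists (Q : Type) (ll : Q -> Q -> Prop) (B : Q -> set X),
    FY_pi_domain ll B.

(* Main.v *)
Require Import Defs.
From mathcomp Require Import all_boot.
From mathcomp Require Import boolp classical_sets topology.
From mathcomp Require Import cardinality.

(** Countable domain representability is witnessed by the boxes
    "agree with [x] on the countable set [A]", ordered by extension of the
    partial functions: a countable directed union of such partial functions
    is again one.

    For the negative part, let [(Q, ll, B)] be a pi-domain. A coordinate [a] is
    decided by [D : set Q] if some [q] in [D] forces [y a = 1] for all [y] in
    [B q]. For a countable directed [D] the intersection of the [B q] contains
    a nonempty open set, because countable intersections of open sets of the
    sigma-product are open; so [D] extends to a countable directed set deciding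
    a new coordinate. On the other hand, the union of a chain of countable
    directed sets is directed, so some point [x] lies in its intersection, and
    every coordinate decided along the chain is in the countable support of
    [x]: countably many members of the chain decide as much as all of it.
    Hence Zorn's lemma applies and gives a contradiction. *)

Set Implicit Arguments.
Unset Strict Implicit.
Unset Printing Implicit Defensive.

Local Open Scope classical_set_scope.

(** * Boxes in the sigma-product and countable domain representability *)

Section SigmaCube.
Variable W : Type.
Implicit Types (A : set W) (x y : sigma_cube W) (a : W).

Definition box A x : set (sigma_cube W) :=
  [set y | forall a, A a -> sval y a = sval x a].

Lemma boxE A x : box A x = @pr W A @^-1` [set pr x].
Proof.
apply/seteqP; split=> y /= yx.
  by apply: funext => -[a aA]; apply: yx; exact: set_mem aA.
move=> a /mem_set aA; exact: (congr1 (@^~ (exist _ a aA)) yx).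
Qed.

Lemma open_box A x : countable A -> open (box A x).
Proof.
move=> cA; exists [set box A x]; last by rewrite bigcup_set1.
by move=> _ ->; exists A => //; exists (pr x); rewrite boxE.
Qed.

Lemma open_sub_box (U : set (sigma_cube W)) x :
  open U -> U x -> exists2 A, countable A & box A x `<=` U.
Proof.
move=> [D' D'b <-] [V D'V Vx]; have [A cA [z Vz]] := D'b _ D'V.
exists A => //; rewrite boxE => y yx; exists V => //; rewrite Vz in Vx *.
by rewrite /= yx.
Qed.

(* The sigma-product is a P-space: its G_delta sets are open. *)
Lemma bigcap_sub_box (Q : Type) (D : set Q) (B : Q -> set (sigma_cube W)) x :
  countable D -> (forall q, open (B q)) -> (\bigcap_(q in D) B q) x ->
  exists2 A, countable A & box A x `<=` \bigcap_(q in D) B q.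
Proof.
move=> cD oB Bx.
have /choice[A HA] q : exists A, D q -> countable A /\ box A x `<=` B q.
  have [/Bx Bqx|nDq] := pselect (D q); last by exists set0.
  by have [A cA AB] := open_sub_box (oB q) Bqx; exists A.
exists (\bigcup_(q in D) A q).
  by apply: bigcup_countable => // q /HA[].
move=> y yx q Dq; have [_] := HA _ Dq; apply=> a Aa.
by apply: yx; exists q.
Qed.

Lemma supp_countable_sub A (f : W -> bool) :
  countable A -> supp f `<=` A -> countable (supp f).
Proof. by move=> cA fA; apply: sub_countable cA; apply: subset_card_le. Qed.

Lemma countable_set1U A a : countable A -> countable (A `|` [set a]).
Proof.
by move=> cA; rewrite -bigcup2E; apply: bigcup_countable => // -[|[|]] //=.
Qed.

Lemma exists_box_true A x a : ~ A a ->
  exists2 y, box A x y & sval y a.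
Proof.
move=> nAa.
pose f b := `[< b = a >] || sval x b.
have cf : countable (supp f).
  apply: (supp_countable_sub (countable_set1U a (svalP x))) => b.
  by rewrite /supp /= => /orP[/asboolP|]; [right|left].
exists (exist _ f cf); last by rewrite /= /f asboolT.
by move=> b Ab /=; rewrite /f asboolF // => ba; apply: nAa; rewrite -ba.
Qed.

Lemma sigma_cube_nonempty : [set: sigma_cube W] !=set0.
Proof.
have c0 : countable (supp (fun _ : W => false)).
  by apply: supp_countable_sub (countable0 W) _.
by exists (exist (fun x : W -> bool => countable (supp x)) _ c0).
Qed.

Lemma sigma_cube_countably_domain_representable :
  FY_countably_domain_representable (sigma_cube W).
Proof.
pose Q : Type := ({A : set W | countable A} * sigma_cube W)%type.
pose mk A (cA : countable A) x : Q :=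
  (exist (fun A => is_true (countable A)) A cA, x).
pose B (q : Q) := box (sval q.1) q.2.
pose ll (p q : Q) := sval p.1 `<=` sval q.1 /\ B p q.2.
have oB q : open (B q) by apply: open_box; exact: svalP q.1.
exists Q, ll, B; split.
- split=> [q|]; first by split=> //; exists q.2.
  split=> [_ [q _ <-] //|x U]; rewrite nbhsE /= => -[V [oV Vx] VU].
  have [A cA AV] := open_sub_box oV Vx.
  exists (box A x); last exact: subset_trans VU.
  by split=> //; exists (mk _ cA x).
- move=> p q r [pq Bpq] [qr Bqr]; split; first exact: subset_trans qr.
  by move=> a pa; rewrite Bqr ?Bpq //; exact: pq.
- by move=> p q [pq Bpq] y yq a pa; rewrite yq ?Bpq //; exact: pq.
- move=> x; split.
    by exists (mk _ (countable0 W) x).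
  move=> p q Bp Bq.
  have cpq : countable (sval p.1 `|` sval q.1).
    by rewrite -bigcup2E; apply: bigcup_countable => // -[|[|]] //= _;
      [exact: svalP p.1|exact: svalP q.1].
  exists (mk _ cpq x); split=> //.
    by split=> // a; left.
  by split=> // a; right.
- move=> D cD [_ dirD].
  (* The union of the partial functions in [D], extended by 0; its support lies in the countable
     union of their domains. *)
  pose f a := `[< exists2 q : Q, D q & sval q.1 a /\ sval q.2 a >].
  have cf : countable (supp f).
    apply: (@supp_countable_sub (\bigcup_(q in D) sval q.1)).
      by apply: bigcup_countable => // q _; exact: svalP q.1.
    by move=> a /asboolP[q Dq [qa _]]; exists q.
  exists (exist (fun x : W -> bool => countable (supp x)) f cf) => q Dq a qa /=.
  apply/asboolP/idP => [[p Dp [pa pt]]|qt]; last by exists q.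
  (* A common extension [r] of [p] and [q] forces their values at [a] to agree. *)
  have [r [_ [_ pr] [_ qr]]] := dirD _ _ Dp Dq.
  by rewrite -qr // pr.
Qed.

End SigmaCube.

(** * Directedness and unions of chains *)

Section Directed.
Variables (Q : Type) (ll : Q -> Q -> Prop).

(* Directedness without nonemptiness, so that empty chains need no special
   treatment in Zorn's lemma. *)
Definition pairs_bounded (D : set Q) : Prop :=
  forall p q, D p -> D q -> exists r, [/\ D r, ll p r & ll q r].

Lemma pairs_bounded_bigcup (I : Type) (J : set I) (F : I -> set Q) :
  (forall i j, J i -> J j -> F i `<=` F j \/ F j `<=` F i) ->
  (forall i, J i -> pairs_bounded (F i)) ->
  pairs_bounded (\bigcup_(i in J) F i).
Proof.
move=> tot dF p q [i Ji Fp] [j Jj Fq].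
case: (tot _ _ Ji Jj) => [/(_ _ Fp) Fp'|/(_ _ Fq) Fq'].
  by have [r [Fr pr qr]] := dF _ Jj _ _ Fp' Fq; exists r; split=> //; exists j.
by have [r [Fr pr qr]] := dF _ Ji _ _ Fp Fq'; exists r; split=> //; exists i.
Qed.

End Directed.

(** * Extending countable directed sets in a pi-domain *)

Section PiDomain.
Variables (X : topologicalType) (Q : Type) (ll : Q -> Q -> Prop).
Variables (B : Q -> set X).
Hypothesis piB : FY_pi_domain ll B.

Lemma pi_domain_bigcap (D : set Q) :
  [set: X] !=set0 -> pairs_bounded ll D -> \bigcap_(q in D) B q !=set0.
Proof.
move=> X0 dD; have [D0|/set0P Dn0] := eqVneq D set0.
  by rewrite D0 bigcap_set0.
exact: (piD5 piB).
Qed.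

(* Upper bounds for the new element and each element of D, taken one by one,
   need not be compatible with each other; they are taken along a chain. *)
Lemma pi_domain_extend (D : set Q) (U : set X) :
  countable D -> pairs_bounded ll D -> open U -> U !=set0 ->
  U `<=` \bigcap_(q in D) B q ->
  exists D', [/\ D `<=` D', countable D', pairs_bounded ll D' &
                 exists2 q, D' q & B q `<=` U].
Proof.
move=> cD dD oU U0 UD.
have [_ [q0 _ <-] q0U] := (piD1 piB).2.2 _ oU U0.
have B0 q : B q !=set0 by have [/(_ q)[]] := piD1 piB.
have /countable_injP[f f_inj] := cD.
pose T := {q | B q `<=` U}.
(* The counter is the code under [f] of the element of [D], if any, to be bounded at this step. *)
pose R (nr ns : nat * T) := [/\ ns.1 = nr.1.+1, ll (sval nr.2) (sval ns.2) &
  forall q, D q -> f q = nr.1 -> ll q (sval ns.2)].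
have RP nr : {ns | R nr ns}.
  case: nr => n [r rU]; apply/cid.
  suff [s [rs qs]] : exists s, ll r s /\ forall q, D q -> f q = n -> ll q s.
    have sU : B s `<=` U by apply: subset_trans rU; exact: piD3 piB _ _ rs.
    by exists (n.+1, exist _ s sU).
  have [z zr] := B0 r.
  have [[q Dq fq]|nq] := pselect (exists2 q, D q & f q = n).
    have [|s [rs qs]] := piD4 piB (p := r) (q := q).
      (* Since [B r] lies in [U], it lies in [B q], so the two sets meet. *)
      by exists z; split=> //; exact: UD (rU _ zr) _ Dq.
    exists s; split=> // q' Dq' fq'.
    by rewrite (f_inj q' q) ?inE // fq fq'.
  have [|s [rs _]] := piD4 piB (p := r) (q := r); first by exists z.
  by exists s; split=> // q Dq fq; case: nq; exists q.
have [g [g0 gS]] := dependent_choice RP (0, exist _ q0 q0U).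
pose r n := sval (g n).2.
have g1 n : (g n).1 = n.
  by elim: n => [|n IHn]; [rewrite g0|have [-> _ _] := gS n; rewrite IHn].
have rlt : forall m n, (m < n)%N -> ll (r m) (r n).
  apply: homo_ltn => [s p t|n]; first exact: (piD2 piB).
  by have [] := gS n.
have Dr q n : D q -> (f q < n)%N -> ll q (r n).
  move=> Dq fn; have qr : ll q (r (f q).+1).
    by have [_ _] := gS (f q); apply=> //; rewrite g1.
  have := fn; rewrite leq_eqVlt => /orP[/eqP <- //|lt].
  exact: (piD2 piB) qr (rlt _ _ lt).
exists (D `|` range r); split.
- by move=> q; left.
- rewrite -bigcup2E; apply: bigcup_countable => // -[|[|]] //= _.
  exact: card_image_le.
(* Each element is below all sufficiently late terms of the chain, so any two have a common bound
   there. *)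
- have bound p : (D `|` range r) p -> exists m, forall n, (m < n)%N -> ll p (r n).
    by case=> [Dp|[m _ <-]]; [exists (f p) => n; exact: Dr|exists m => n; exact: rlt].
  move=> p q /bound[m pm] /bound[n qn]; exists (r (maxn m n).+1); split.
  + by right; exists (maxn m n).+1.
  + by apply: pm; rewrite ltnS leq_maxl.
  + by apply: qn; rewrite ltnS leq_maxr.
- by exists (r 0) => //; [right; exists 0|rewrite /r g0].
Qed.

End PiDomain.

(** * Decided coordinates and the Zorn argument *)

Section NotPiDomain.
Variables (W : Type) (Q : Type) (ll : Q -> Q -> Prop).
Variables (B : Q -> set (sigma_cube W)).
Hypothesis piB : FY_pi_domain ll B.

Definition decided (D : set Q) : set W :=
  [set a | exists2 q, D q & B q `<=` [set y : sigma_cube W | sval y a]].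

Lemma decided_sub (D D' : set Q) : D `<=` D' -> decided D `<=` decided D'.
Proof. by move=> DD' a [q /DD' Dq Bq]; exists q. Qed.

Lemma decided_countable (D : set Q) : pairs_bounded ll D -> countable (decided D).
Proof.
move=> dD; have [x xD] := pi_domain_bigcap piB (sigma_cube_nonempty W) dD.
apply: sub_countable (svalP x); apply: subset_card_le => a [q Dq qa].
exact/qa/xD.
Qed.

Lemma decided_extend (D : set Q) :
  ~ countable [set: W] -> countable D -> pairs_bounded ll D ->
  exists D', [/\ D `<=` D', countable D', pairs_bounded ll D' &
                 ~ decided D' `<=` decided D].
Proof.
move=> uW cD dD.
have [x xD] := pi_domain_bigcap piB (sigma_cube_nonempty W) dD.
have oB q : open (B q) by have [/(_ q)[]] := piD1 piB.
have [A cA AD] := bigcap_sub_box cD oB xD.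
(* Outside [A] the coordinate can be set to 1 without leaving the intersection; outside [decided D]
   it is new. *)
have [a na] : exists a, ~ (A `|` decided D) a.
  apply/existsNP => all; apply: uW; apply: (@sub_countable _ _ _ (A `|` decided D)).
    by apply: subset_card_le => a _; exact: all.
  rewrite -bigcup2E; apply: bigcup_countable => // -[|[|]] //= _.
  exact: decided_countable.
have [y yA ya] : exists2 y, box A x y & sval y a.
  by apply: exists_box_true => // Aa; apply: na; left.
have [|||D' [DD' cD' dD' [q D'q qU]]] :=
    pi_domain_extend piB (U := box (A `|` [set a]) y) cD dD.
- exact/open_box/countable_set1U.
- by exists y.
- by move=> z zy; apply: AD => b Ab; rewrite zy ?yA //; left.
exists D'; split=> // D'D; apply: na; right; apply: D'D; exists q => // z /qU.
by move=> /(_ a) /= -> //; right.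
Qed.

Lemma pi_domain_sigma_cube_countable : countable [set: W].
Proof.
apply: contrapT => uW.
pose T := {D : set Q | countable D /\ pairs_bounded ll D}.
(* A strict increase must also decide a new coordinate. *)
pose R (D E : T) := `[< sval D `<=` sval E /\
  (decided (sval E) `<=` decided (sval D) -> sval E `<=` sval D) >].
have t0 : T by exists set0; split=> //; exact: countable0.
have [||C totC|[D [cD dD]] maxD] := @ZL_preorder T t0 R.
- by move=> D; apply/asboolP; split=> [|_]; exact: subset_refl.
- move=> D E F /asboolP[DE mDE] /asboolP[EF mEF]; apply/asboolP; split.
    exact: subset_trans EF.
  move=> FD; have FE : sval F `<=` sval E.
    by apply: mEF; apply: subset_trans FD _; exact: decided_sub.
  apply: subset_trans FE _.
  by apply: mDE; apply: subset_trans _ FD; exact: decided_sub.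
- have comp (D E : T) : C D -> C E -> sval D `<=` sval E \/ sval E `<=` sval D.
    by move=> CD CE; case: (totC _ _ CD CE) => /asboolP[]; [left|right].
  pose E := \bigcup_(D in C) sval D.
  have dE : pairs_bounded ll E.
    by apply: pairs_bounded_bigcup comp _ => D _; have [] := svalP D.
  have subE D : C D -> sval D `<=` E by move=> CD q Dq; exists D.
  (* If one member of the chain decides all that [E] does, it is itself an upper bound, as no member
     can strictly increase past it. *)
  have [[D CD ED]|nmax] :=
      pselect (exists2 D, C D & decided E `<=` decided (sval D)).
    exists D => F CF; case: (totC _ _ CF CD) => // /asboolP[DF mDF].
    apply/asboolP; split; last by [].
    by apply: mDF; apply: subset_trans ED; exact/decided_sub/subE.
  have /choice[G HG] a : exists D : T, decided E a ->
      C D /\ decided (sval D) a.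
    have [[q [D CD Dq] qa]|na] := pselect (decided E a); last by exists t0.
    by exists D => _; split=> //; exists q.
  pose F := \bigcup_(a in decided E) sval (G a).
  have cF : countable F.
    apply: bigcup_countable; first exact: decided_countable.
    by move=> a _; have [] := svalP (G a).
  have dF : pairs_bounded ll F.
    apply: pairs_bounded_bigcup => [a b /HG[Ga _] /HG[Gb _]|a _].
      exact: comp.
    by have [] := svalP (G a).
  have EF : decided E `<=` decided F.
    move=> a Ea; have [_] := HG _ Ea; apply: decided_sub.
    by move=> q Gq; exists a.
  exists (exist _ F (conj cF dF)) => D CD; apply/asboolP; split=> /=.
    (* [G a] decides a coordinate that [D] does not, so comparability puts [D] inside [G a], hence
       inside [F]. *)
    have [a [Ea nDa]] : exists a, decided E a /\ ~ decided (sval D) a.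
      apply: contrapT => /forallNP ED; apply: nmax; exists D => // a Ea.
      by apply: contrapT => nDa; apply: (ED a).
    have [CG Ga] := HG _ Ea; case: (comp _ _ CD CG) => [DG q Dq|GD].
      by exists a => //; exact: DG.
    by case: nDa; exact: decided_sub Ga.
  by move=> FD; case: nmax; exists D => //; exact: subset_trans FD.
have [D' [DD' cD' dD' nD']] := decided_extend uW cD dD.
(* The second clause of [R] holds vacuously, because [D'] decides a new coordinate. *)
have /maxD/asboolP[/= D'D _] : R (exist _ D (conj cD dD)) (exist _ D' (conj cD' dD')).
  by apply/asboolP.
by apply: nD'; exact: decided_sub.
Qed.

End NotPiDomain.

Theorem mainTheorem3 (W : Type) (le : rel W) (hW : is_omega1 le) :
  FY_countably_domain_representable (sigma_cube W) /\
  ~ FY_pi_domain_representable (sigma_cube W).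
Proof.
split; first exact: sigma_cube_countably_domain_representable.
move=> [Q [ll [B piB]]]; have [_ uW _] := hW.
exact: uW (pi_domain_sigma_cube_countable piB).
Qed.
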